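(* Let $0<\alpha<1$, $\tau>0$, let $\lambda$ be a (real or complex) constant, let $f:[0,+\infty)\to\mathbb{R}$ be continuous, and let $\phi(t)=(t/\tau+1)y_0$ for $t\in[-\tau,0]$, for some $y_0\in\mathbb{R}$. Then for every $t\ge0$ the exact solution of $$ {}^{C}\!D^{\alpha}_{0}y(t)=\lambda y(t-\tau)+f(t)\ (t>0),\qquad y(t)=\phi(t)\ (-\tau\le t\le0) $$ is $$ y(t)=\frac{1}{\tau}\left[\sum_{k=0}^{\lfloor t/\tau\rfloor+1}\frac{\lambda^{k}(t+\tau-\tau k)^{\alpha k+1}}{\Gamma(\alpha k+2)}-\sum_{k=0}^{\lfloor t/\tau\rfloor}\frac{\lambda^{k}(t-\tau k)^{\alpha k+1}}{\Gamma(\alpha k+2)}\right]y_0+\mathcal{J}_{0,\tau,\lambda}f(t). $$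
   Context: The Caputo derivative is ${}^{C}\!D^{\alpha}_{0}y=J_0^{1-\alpha}y'$, where $J_0^{\beta}u(t)=\frac{1}{\Gamma(\beta)}\int_0^t(t-r)^{\beta-1}u(r)\,dr$. A solution of the delay problem is a continuous function $y$ on $[-\tau,\infty)$ with $y=\phi$ on $[-\tau,0]$ satisfying the equation in its equivalent integral form $y(t)=\phi(0)+\frac{1}{\Gamma(\alpha)}\int_0^t(t-r)^{\alpha-1}\bigl[\lambda y(r-\tau)+f(r)\bigr]dr$ for $t\ge0$. The generalized integral is $$\mathcal{J}_{0,\tau,\lambda}f(t):=\sum_{k=0}^{\lfloor t/\tau\rfloor}\frac{\lambda^k}{\Gamma(\alpha k+\alpha)}\int_0^{t-k\tau}(t-k\tau-r)^{\alpha k+\alpha-1}f(r)\,dr .$$ *)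

(* Defs.v *)
From HB Require Import structures.
From mathcomp Require Export all_boot all_order all_algebra.
From mathcomp Require Export complex.
From mathcomp Require Export all_classical all_reals all_analysis.
Export numFieldNormedType.Exports.
Export Order.TTheory GRing.Theory Num.Theory.

Set Implicit Arguments.
Unset Strict Implicit.
Unset Printing Implicit Defensive.

#[global] Open Scope classical_set_scope.
#[global] Open Scope ring_scope.
#[global] Open Scope complex_scope.

Definition Gamma (R : realType) (s : R) : R :=
  \int[lebesgue_measure]_(x in `]0, +oo[) (x `^ (s - 1) * expR (- x)).

(* Lebesgue integral of a complex-valued function, componentwise. *)
Definition Cintegral (R : realType) (D : set R) (u : R -> R[i]) : R[i] :=
  (\int[lebesgue_measure]_(x in D) complex.Re (u x)) +i*
  (\int[lebesgue_measure]_(x in D) complex.Im (u x)).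

(* J_0^beta u (t). At the endpoint r = t the kernel takes the junk value
   [0 `^ (beta - 1)], which is irrelevant since {t} is a null set. *)
Definition RLint (R : realType) (beta : R) (u : R -> R[i]) (t : R) : R[i] :=
  ((Gamma beta)^-1)%:C *
  Cintegral `[0, t] (fun r => ((t - r) `^ (beta - 1))%:C * u r).

(* The delay problem  ^C D^alpha_0 y(t) = lambda y(t - tau) + f(t) (t > 0),
   y = phi on [-tau, 0], whose solutions are by definition the continuous
   functions on [-tau, +oo[ satisfying the equivalent integral equation.
   Only the restriction of y to [-tau, +oo[ is constrained; the alias R[i]^o
   carries the norm topology of R[i]. *)
Definition is_delay_solution (R : realType) (alpha tau : R) (lambda : R[i])
    (f phi : R -> R) (y : R -> R[i]) : Prop :=
  [/\ {within `[- tau, +oo[, continuous (y : R -> R[i]^o)},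
      forall t : R, - tau <= t <= 0 -> y t = (phi t)%:C &
      forall t : R, 0 <= t ->
        y t = (phi 0)%:C
              + RLint alpha (fun r => lambda * y (r - tau) + (f r)%:C) t].

(* floor (t / tau); only used for t / tau >= 0, where the absolute value is a
   mere cast from int to nat. *)
Definition delay_index (R : realType) (tau t : R) : nat :=
  `|Num.floor (t / tau)|%N.

Definition Jgen (R : realType) (alpha tau : R) (lambda : R[i]) (f : R -> R)
    (t : R) : R[i] :=
  \sum_(0 <= k < (delay_index tau t).+1)
    lambda ^+ k / (Gamma (alpha * k%:R + alpha))%:C *
    (\int[lebesgue_measure]_(r in `[0%R, t - k%:R * tau])
        ((t - k%:R * tau - r) `^ (alpha * k%:R + alpha - 1) * f r))%:C.

(* Main.v *)
Require Import Defs.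
From mathcomp Require Import measurable_realfun ring lra.

(* Write J^b h = h * k_b for the Riemann-Liouville integral, a convolution with
   the kernel k_b(x) = x^(b-1) / Gamma(b) supported on x > 0.  Tonelli's theorem
   makes convolution of nonnegative functions associative, and the Beta integral
   (itself Tonelli plus a scaling) gives k_a * k_b = k_(a+b).  Hence
   J^a (J^b h (. - c)) = (J^(a+b) h)(. - c) for causal h and c >= 0.
   The powers of the closed formula are translates of the kernels
   k_(alpha k + 2) and its last part consists of translates of
   J^(alpha k + alpha) f; so lambda * J^alpha of the k-th term delayed by tau is
   the (k+1)-st term, and the sum solves the integral equation.  Solutions are
   unique because the equation determines y on [0, (n+1) tau] from its values on
   [- tau, n tau]. *)

Set Implicit Arguments.
Unset Strict Implicit.
Unset Printing Implicit Defensive.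

(** * Convolution of nonnegative functions on the real line *)

Section convolution.
Local Open Scope ereal_scope.
Context {R : realType}.
Implicit Types (u v w : R -> \bar R).
Local Notation mu := (@lebesgue_measure R).

(** The pushforward of Lebesgue measure under x -> c x + d, scaled by c, gives every half-open
    interval its length, so it is Lebesgue measure by uniqueness. *)
Lemma ge0_integral_affine (c d : R) u : (0 < c)%R ->
  measurable_fun [set: R] u -> (forall x, 0 <= u x) ->
  c%:E * \int[mu]_x u (c * x + d)%R = \int[mu]_x u x.
Proof.
move=> c0 mu_ u0.
pose phi : R -> measurableTypeR R := fun x => (c * x + d)%R.
have mphi : measurable_fun [set: R] phi.
  by apply: measurable_funD => //; exact: mulrl_measurable.
have [c' c'E] : exists c' : {nonneg R}, c'%:num = c by exists (NngNum (ltW c0)).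
have <- : \int[pushforward mu phi]_y u y = \int[mu]_x u (c * x + d)%R.
  by rewrite ge0_integral_pushforward.
rewrite -c'E -ge0_integral_mscale//.
apply: eq_measure_integral => A mA _; apply/esym.
apply: lebesgue_measure_unique => // _ [[a b]] _ <-.
rewrite /= /mscale /= /pushforward c'E.
rewrite (_ : phi @^-1` _ = `](a - d) / c, (b - d) / c]%classic)%R; last first.
  apply/seteqP; split => x /=; rewrite !in_itv/= /phi.
    by rewrite -ltrBlDr -lerBrDr ltr_pdivrMr// ler_pdivlMr// mulrC.
  by rewrite -ltrBlDr -lerBrDr ltr_pdivrMr// ler_pdivlMr// mulrC.
rewrite !lebesgue_measure_itv/= !lte_fin.
rewrite ltr_pM2r ?invr_gt0// ltrD2r; case: ifPn => _; last by rewrite mule0.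
rewrite -EFinB -EFinM; congr EFin.
by rewrite -mulrBl opprB addrA subrK mulrC divfK// gt_eqF.
Qed.

Lemma ge0_integral_shift (d : R) u : measurable_fun [set: R] u ->
  (forall x, 0 <= u x) -> \int[mu]_x u (x - d)%R = \int[mu]_x u x.
Proof.
move=> mu_ u0; rewrite -(@ge0_integral_affine 1%R (- d)%R u)// mul1e.
by apply: eq_integral => x _; rewrite mul1r.
Qed.

Lemma ge0_integral_opp u : measurable_fun [set: R] u ->
  (forall x, 0 <= u x) -> \int[mu]_x u (- x)%R = \int[mu]_x u x.
Proof.
move=> mu_ u0.
have <- : \int[pushforward mu (-%R : _ -> measurableTypeR R)]_y u y
    = \int[mu]_x u (- x)%R by rewrite ge0_integral_pushforward.
by apply: eq_measure_integral => A mA _; exact: lebesgue_measureN.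
Qed.

Lemma ge0_integral_reflect (d : R) u : measurable_fun [set: R] u ->
  (forall x, 0 <= u x) -> \int[mu]_x u (d - x)%R = \int[mu]_x u x.
Proof.
move=> mu_ u0; rewrite -[RHS]ge0_integral_opp//.
rewrite -[RHS](ge0_integral_shift d)//; last first.
  by apply: measurableT_comp => //; exact: oppr_measurable.
by apply: eq_integral => x _; rewrite opprB.
Qed.

(** Values are extended reals, so commutativity and associativity hold for all nonnegative
    measurable functions and finiteness is settled separately. *)
Definition conv u v (t : R) := \int[mu]_s (u (t - s)%R * v s).

Lemma measurable_fun_subr (t : R) : measurable_fun [set: R] (fun s : R => t - s)%R.
Proof. by apply: measurable_funB. Qed.

Section theory.
Variables (u v : R -> \bar R).
Hypotheses (mfu : measurable_fun [set: R] u) (mfv : measurable_fun [set: R] v).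
Hypotheses (u0 : forall x, 0 <= u x) (v0 : forall x, 0 <= v x).

Lemma measurable_conv_integrand :
  measurable_fun [set: R * R] (fun p => u (p.1 - p.2)%R * v p.2).
Proof.
apply: emeasurable_funM; last by apply: measurableT_comp.
apply: measurableT_comp => //.
by apply: measurable_funB; [exact: measurable_fst|exact: measurable_snd].
Qed.

Lemma measurable_conv : measurable_fun [set: R] (conv u v).
Proof.
apply: (measurable_fun_fubini_tonelli_F (m2 := mu)
  (fun p : R * R => u (p.1 - p.2)%R * v p.2)).
  exact: measurable_conv_integrand.
by move=> p; exact: mule_ge0.
Qed.

Lemma conv_ge0 t : 0 <= conv u v t.
Proof. by apply: integral_ge0 => s _; exact: mule_ge0. Qed.

Lemma measurable_conv1 t : measurable_fun [set: R] (fun s => u (t - s)%R * v s).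
Proof.
apply: emeasurable_funM => //.
by apply: measurableT_comp => //; exact: measurable_fun_subr.
Qed.

Lemma convC t : conv u v t = conv v u t.
Proof.
rewrite /conv -(ge0_integral_reflect t)//; first last.
- by move=> x; exact: mule_ge0.
- exact: measurable_conv1.
by apply: eq_integral => s _; rewrite subKr muleC.
Qed.

(** Tonelli, then translation invariance of the inner integral. Applied to the Gamma integrands it
    produces Gamma(a) Gamma(b). *)
Lemma integral_conv :
  \int[mu]_t conv u v t = \int[mu]_t u t * \int[mu]_t v t.
Proof.
transitivity (\int[mu]_s \int[mu]_t (u (t - s)%R * v s)).
  apply: (fubini_tonelli (m1 := mu) (m2 := mu)
    (fun p : R * R => u (p.1 - p.2)%R * v p.2)).
    exact: measurable_conv_integrand.
  by move=> p; exact: mule_ge0.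
rewrite -ge0_integralZl//; last exact: integral_ge0.
apply: eq_integral => s _.
rewrite ge0_integralZr//; last first.
  by apply: measurableT_comp => //; apply: measurable_funB.
by rewrite ge0_integral_shift.
Qed.

Lemma conv_shift (c t : R) :
  conv u (fun s => v (s - c)%R) t = conv u v (t - c)%R.
Proof.
rewrite /conv -(@ge0_integral_shift c (fun s => u (t - c - s)%R * v s)).
- by apply: eq_integral => s _; rewrite opprB addrA subrK.
- exact: measurable_conv1.
- by move=> x; exact: mule_ge0.
Qed.

End theory.

(** Tonelli exchanges s and r; the inner integral is then u convolved with v translated by r, which
    [conv_shift] evaluates as [conv u v] at t - r. *)
Lemma convA u v w t :
  measurable_fun [set: R] u -> measurable_fun [set: R] v -> measurable_fun [set: R] w ->
  (forall x, 0 <= u x) -> (forall x, 0 <= v x) -> (forall x, 0 <= w x) ->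
  conv u (conv v w) t = conv (conv u v) w t.
Proof.
move=> mfu mfv mfw u0 v0 w0.
transitivity (\int[mu]_s \int[mu]_r (u (t - s)%R * (v (s - r)%R * w r))).
  apply: eq_integral => s _.
  rewrite ge0_integralZl//; first exact: measurable_conv1.
  by move=> r _; exact: mule_ge0.
transitivity (\int[mu]_r \int[mu]_s (u (t - s)%R * (v (s - r)%R * w r))).
  apply: (fubini_tonelli (m1 := mu) (m2 := mu)
    (fun p : R * R => u (t - p.1)%R * (v (p.1 - p.2)%R * w p.2))).
    apply: emeasurable_funM; last exact: measurable_conv_integrand.
    apply: measurableT_comp => //.
    by apply: measurable_funB => //; exact: measurable_fst.
  by move=> p; rewrite !mule_ge0.
apply: eq_integral => r _.
transitivity (\int[mu]_s (u (t - s)%R * v (s - r)%R * w r)).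
  by apply: eq_integral => s _; rewrite muleA.
have mvr : measurable_fun [set: R] (fun s => v (s - r)%R).
  by apply: measurableT_comp => //; exact: measurable_funB.
rewrite ge0_integralZr//.
- by congr (_ * _); exact: conv_shift.
- exact: measurable_conv1.
- by move=> s _; exact: mule_ge0.
Qed.

End convolution.

(** * Beta and Gamma integrals *)

Section gamma.
Local Open Scope ereal_scope.
Context {R : realType}.
Local Notation mu := (@lebesgue_measure R).

(** A zero integral would force u = 0 almost everywhere, whereas []a, b[] has positive measure. *)
Lemma integral_gt0 (u : R -> \bar R) (a b : R) : (a < b)%R ->
  measurable_fun [set: R] u -> (forall x, 0 <= u x) ->
  (forall x, (a < x < b)%R -> 0 < u x) -> 0 < \int[mu]_x u x.
Proof.
move=> ab mfu u0 ugt0; rewrite lt0e integral_ge0 ?andbT//.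
apply/eqP => intu0.
have /(ae_eq_integral_abs mu measurableT mfu) : \int[mu]_x `|u x| = 0.
  by rewrite -intu0; apply: eq_integral => x _; rewrite gee0_abs.
move=> [N [mN N0 uN]].
have : mu `]a, b[ <= mu N.
  rewrite le_measure ?inE//; move=> x /=; rewrite in_itv/= => xab.
  by apply: uN => /= /(_ I) ux0; have := ugt0 _ xab; rewrite ux0 ltxx.
by rewrite N0 lebesgue_measure_itv/= lte_fin ab -EFinB lee_fin subr_le0 leNgt ab.
Qed.

(** The cut-off at 0 turns a convolution over the whole line into an integral over ]0, t[. *)
Definition pker (a x : R) : R := if (0 < x)%R then (x `^ (a - 1))%R else 0%R.

Lemma pker_ge0 a x : (0 <= pker a x)%R.
Proof. by rewrite /pker; case: ifP => // _; exact: powR_ge0. Qed.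

Lemma pker_gt0 a x : (0 < x)%R -> (0 < pker a x)%R.
Proof. by move=> x0; rewrite /pker x0 powR_gt0. Qed.

Lemma pker_le0 a x : (x <= 0)%R -> pker a x = 0%R.
Proof. by rewrite /pker ltNge => ->. Qed.

Lemma measurable_pker a : measurable_fun [set: R] (pker a).
Proof. by apply: measurable_fun_ifT => //; exact: measurable_fun_ltr. Qed.

Lemma pkerM a c x : (0 < c)%R -> pker a (c * x) = (c `^ (a - 1) * pker a x)%R.
Proof.
move=> c0; rewrite /pker pmulr_rgt0//; case: ifPn => x0; last by rewrite mulr0.
by rewrite powRM// ltW.
Qed.

Local Notation P a := (EFin \o pker a).
Let mP a : measurable_fun [set: R] (P a).
Proof. by apply/measurable_EFinP; exact: measurable_pker. Qed.
Let P0 a x : 0 <= P a x.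
Proof. by rewrite lee_fin pker_ge0. Qed.

(** Euler's Beta function B(a, b), the integral of (1 - s)^(a-1) s^(b-1) over ]0, 1[, possibly
    infinite. *)
Definition ebeta a b := conv (P a) (P b) 1%R.

(** For z > 0 the substitution s = z x extracts z^(1 + (a-1) + (b-1)) = z^(a+b-1); for z <= 0 the
    two factors are never both nonzero. *)
Lemma conv_pker a b z :
  conv (P a) (P b) z = (pker (a + b) z)%:E * ebeta a b.
Proof.
have [z0|z0] := leP z 0%R.
  rewrite pker_le0// mul0e; apply: integral0_eq => s _; rewrite /= -EFinM.
  have [s0|s0] := leP s 0%R; first by rewrite (pker_le0 b)// mulr0.
  by rewrite pker_le0 ?mul0r// subr_le0 (le_trans z0)// ltW.
transitivity (z%:E * \int[mu]_x (P a (z - (z * x + 0))%R * P b (z * x + 0)%R)).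
  apply/esym/(@ge0_integral_affine _ z 0%R (fun s => P a (z - s)%R * P b s)) => //.
    exact: measurable_conv1.
  by move=> x; exact: mule_ge0.
under eq_integral => s _.
  rewrite addr0 -{1}(mulr1 z) -mulrBr /= !pkerM// -EFinM mulrACA EFinM.
  over.
rewrite ge0_integralZl//; last first.
- by rewrite lee_fin mulr_ge0// powR_ge0.
- by move=> s _; rewrite lee_fin mulr_ge0// pker_ge0.
- apply/measurable_EFinP/measurable_funM; last exact: measurable_pker.
  by apply: measurableT_comp; [exact: measurable_pker|exact: measurable_fun_subr].
rewrite muleA -EFinM /ebeta /conv; congr (_%:E * _).
rewrite /pker z0 -powRD; last by rewrite (gt_eqF z0) implybT.
rewrite -{1}(powRr1 (ltW z0)) -powRD ?(gt_eqF z0) ?implybT//.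
by congr (_ `^ _)%R; ring.
Qed.

Lemma ebeta_gt0 a b : 0 < ebeta a b.
Proof.
apply: (@integral_gt0 _ 0%R 1%R) => //.
- exact: measurable_conv1.
- by move=> x; exact: mule_ge0.
- move=> x /andP[x0 x1]; rewrite -EFinM lte_fin mulr_gt0// pker_gt0//.
  by rewrite subr_gt0.
Qed.

Definition gammaf a x := (pker a x * expR (- x))%:E.

Let mE a : measurable_fun [set: R] (gammaf a).
Proof.
apply/measurable_EFinP; apply: measurable_funM; first exact: measurable_pker.
by apply: measurableT_comp => //; exact: measurableT_comp.
Qed.

Let E0 a x : 0 <= gammaf a x.
Proof. by rewrite lee_fin mulr_ge0 ?pker_ge0 ?expR_ge0. Qed.

(** The Gamma integral as an extended real: its product formula is proved first, and finiteness is
    then derived from it. *)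
Definition egamma a := \int[mu]_x gammaf a x.

Lemma GammaE a : Gamma a = fine (egamma a).
Proof.
rewrite /Gamma /Rintegral integral_mkcond; congr fine.
apply: eq_integral => x _; rewrite /gammaf /pker patchE.
have -> : (x \in `]0%R, +oo[%classic) = (0 < x)%R.
  by apply/idP/idP; rewrite inE/= in_itv/= andbT.
by case: ifP => // _; rewrite mul0r.
Qed.

Lemma egamma_gt0 a : 0 < egamma a.
Proof.
apply: (@integral_gt0 _ 0%R 1%R) => // x /andP[x0 _].
by rewrite lte_fin mulr_gt0 ?pker_gt0 ?expR_gt0.
Qed.

(** In the convolution of the two Gamma integrands, e^(-(z-s)) e^(-s) = e^(-z) leaves the integral
    over s, and [conv_pker] evaluates what remains. *)
Lemma egammaM a b : egamma a * egamma b = ebeta a b * egamma (a + b).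
Proof.
rewrite /egamma -integral_conv//.
rewrite -ge0_integralZl//; [|exact: mE|exact/ltW/ebeta_gt0].
apply: eq_integral => z _.
transitivity ((expR (- z))%:E * conv (P a) (P b) z); last first.
  by rewrite conv_pker /gammaf muleA muleC -EFinM [(expR _ * _)%R]mulrC.
rewrite /conv -ge0_integralZl//; first last.
- by move=> s _; exact: mule_ge0.
- exact: measurable_conv1.
apply: eq_integral => s _; rewrite /gammaf /= -!EFinM; congr EFin.
rewrite mulrACA -expRD (_ : - (z - s) - s = - z)%R; last by ring.
by rewrite mulrC.
Qed.

Lemma egamma1 : egamma 1%R = 1.
Proof.
rewrite -(@integral_exponential_pdf R 1)//.
transitivity (\int[mu]_(x in `]0%R, +oo[) (exponential_pdf 1 x)%:E).
  rewrite integral_mkcond; apply: eq_integral => x _; rewrite /gammaf /pker patchE.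
  have -> : (x \in `]0%R, +oo[%classic) = (0 < x)%R.
    by rewrite mem_setE in_itv/= andbT.
  case: ifPn => x0; last by rewrite mul0r.
  by rewrite subrr powRr0 mul1r exponential_pdfE ?ltW// mul1r mulN1r.
rewrite integral_itv_obnd_cbnd; last first.
  by apply/measurable_EFinP; apply: measurable_funTS; exact: measurable_exponential_pdf.
rewrite integral_mkcond; apply: eq_integral => x _.
by rewrite patchE /exponential_pdf patchE; case: (x \in _).
Qed.

Lemma ebeta11 : ebeta 1%R 1%R = 1.
Proof.
rewrite /ebeta /conv; transitivity (\int[mu]_(x in `]0%R, 1%R[) (cst 1 x)).
  rewrite [RHS]integral_mkcond; apply: eq_integral => x _.
  rewrite patchE mem_setE in_itv/= /= /pker subr_gt0 subrr !powRr0 -EFinM.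
  by case: (0 < x)%R; case: (x < 1)%R; rewrite /= ?mulr1 ?mulr0 ?mul0r.
by rewrite integral_cst//= lebesgue_measure_itv/= lte_fin ltr01 mul1e -EFinB subr0.
Qed.

Lemma egamma2 : egamma 2%R = 1.
Proof.
by have := egammaM 1%R 1%R; rewrite egamma1 ebeta11 !mul1e => <-.
Qed.

(** Monotone convergence along the intervals [1/(i+2), 1], on each of which the antiderivative x^a /
    a bounds the integral by 1/a. *)
Lemma integral_powR_lty a : (0 < a)%R ->
  \int[mu]_(x in `]0%R, 1%R]) (x `^ (a - 1))%:E < +oo.
Proof.
move=> a0.
(* The offset 2 keeps the left endpoint strictly below 1, as the fundamental theorem of calculus
   requires. *)
pose F (i : nat) := (`[i.+2%:R^-1, 1]%classic : set R)%R.
have FE : `]0%R, 1%R]%classic = \bigcup_i F i.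
  apply/seteqP; split => x /=; rewrite in_itv/=.
    move=> /andP[x0 x1]; have [n nx] := ltr_add_invr x0.
    exists n => //; rewrite /F/= in_itv/= x1 andbT.
    rewrite (le_trans _ (ltW nx))// add0r lef_pV2 ?posrE//.
    by rewrite ler_nat.
  move=> [n _]; rewrite /F/= in_itv/= => /andP[nx ->]; rewrite andbT.
  by apply: lt_le_trans nx; rewrite invr_gt0.
have : \int[mu]_(x in F i) (x `^ (a - 1))%:E @[i --> \oo]
    --> \int[mu]_(x in \bigcup_i F i) (x `^ (a - 1))%:E.
  apply: ge0_nondecreasing_set_cvg_integral.
  - apply/nondecreasing_seqP => n; apply/subsetPset => x; rewrite /F/= !in_itv/=.
    move=> /andP[nx ->]; rewrite andbT (le_trans _ nx)// lef_pV2 ?posrE//.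
    by rewrite ler_nat.
  - by move=> i; exact: measurable_itv.
  - move=> i; apply/measurable_EFinP/measurable_funTS.
    exact: measurable_powR.
  - by move=> i x _; rewrite lee_fin powR_ge0.
rewrite -FE => Fcvg; move: (Fcvg) => /cvg_lim <-//.
apply: (@le_lt_trans _ _ (a^-1)%:E); last by rewrite ltry.
apply: lime_le; first by apply/cvg_ex; eexists; exact: Fcvg.
apply: nearW => n.
have n0 : (0 < n.+2%:R^-1 :> R)%R by rewrite invr_gt0.
have dx (x : R) : (0 < x)%R ->
    is_derive x 1%R (fun x => a^-1 * x `^ a)%R (x `^ (a - 1))%R.
  move=> x0.
  have := @is_deriveZ _ _ _ _ a^-1%R x 1%R _ (is_derive1_powR a x0).
  by rewrite /GRing.scale/= mulKf// gt_eqF.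
have cx (x : R) : (0 < x)%R -> {for x, continuous (fun x => a^-1 * x `^ a)%R}.
  move=> x0; apply/differentiable_continuous/derivable1_diffP.
  by have [] := dx _ x0.
rewrite (@continuous_FTC2 _ _ (fun x => a^-1 * x `^ a)%R).
- rewrite powR1 mulr1 -EFinB lee_fin lerBlDr lerDl.
  by rewrite mulr_ge0 ?powR_ge0// invr_ge0 ltW.
- by rewrite invf_lt1 ?ltr1n.
- apply: derivable_within_continuous => x; rewrite in_itv/= => /andP[nx _].
  by apply: derivable_powR; rewrite in_itv/= andbT (lt_le_trans n0).
- split.
  + move=> x; rewrite in_itv/= => /andP[nx _].
    by have [] := dx _ (lt_trans n0 nx).
  + by apply: cvg_at_right_filter; exact: cx.
  + by apply: cvg_at_left_filter; exact: cx.
- move=> x; rewrite in_itv/= => /andP[nx _].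
  by rewrite derive1E; have [_ ->] := dx _ (lt_trans n0 nx).
Qed.

(** The integrand is at most x^(a-1) on ]0, 1] and, because a <= 1, at most e^(-x) beyond 1. *)
Lemma egamma_lty_le1 a : (0 < a <= 1)%R -> egamma a < +oo.
Proof.
move=> /andP[a0 a1].
apply: (@le_lt_trans _ _ (\int[mu]_x
   (((fun x => (x `^ (a - 1))%:E) \_ `]0%R, 1%R]) x + (exponential_pdf 1 x)%:E))).
  apply: ge0_le_integral => //.
  - exact: mE.
  - apply: emeasurable_funD.
      apply/(measurable_restrictT (fun x : R => (x `^ (a - 1))%:E)) => //.
      by apply/measurable_EFinP/measurable_funTS; exact: measurable_powR.
    by apply/measurable_EFinP; exact: measurable_exponential_pdf.
  - move=> x _; rewrite patchE mem_setE in_itv/=.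
    have [x0|x0] := leP x 0%R.
      rewrite /gammaf pker_le0// mul0r add0e lee_fin.
      exact: exponential_pdf_ge0.
    have -> : exponential_pdf 1 x = expR (- x).
      by rewrite exponential_pdfE ?ltW//= mul1r mulN1r.
    rewrite /gammaf /pker x0/=.
    (* Off ]0, 1] the restriction takes the default value [point], which is 0 here. *)
    rewrite [point]/(0 : \bar R).
    have [x1|x1] := leP x 1%R; rewrite ?add0e -?EFinD lee_fin.
      rewrite (@le_trans _ _ (x `^ (a - 1)))%R ?lerDl ?expR_ge0//.
      rewrite ler_piMr ?powR_ge0// -[leRHS]expR0 ler_expR oppr_le0 ltW//.
    rewrite ler_piMl ?expR_ge0// //.
    by rewrite -[leRHS](powRr0 x) ler_powR ?(ltW x1)// subr_le0.
rewrite ge0_integralD//; first last.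
- by apply/measurable_EFinP; exact: measurable_exponential_pdf.
- by move=> x _; rewrite lee_fin exponential_pdf_ge0.
- apply/(measurable_restrictT (fun x : R => (x `^ (a - 1))%:E)) => //.
  by apply/measurable_EFinP/measurable_funTS; exact: measurable_powR.
- by move=> x _; rewrite erestrict_ge0// => y _; rewrite lee_fin powR_ge0.
rewrite integral_exponential_pdf// -integral_mkcond.
by rewrite lte_add_pinfty ?ltry//; exact: integral_powR_lty.
Qed.

(** Write a = b n with 0 < b <= 1 and induct along the multiples of b: [egammaM] equates a finite
    product with a positive factor times Gamma at the next multiple, which is therefore finite. *)
Lemma egamma_lty a : (0 < a)%R -> egamma a < +oo.
Proof.
move=> a0; pose n := (Num.truncn a).+1.
have n0 : (0 < n%:R :> R)%R by [].
pose b := (a / n%:R)%R.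
have b0 : (0 < b)%R by rewrite divr_gt0.
have b1 : (b <= 1)%R by rewrite ler_pdivrMr// mul1r ltW// Num.Theory.truncnS_gt.
have -> : a = (b * n%:R)%R by rewrite divfK// gt_eqF.
rewrite /n; elim: (Num.truncn a) => [|k IH].
  by rewrite mulr1 egamma_lty_le1// b0.
have := egammaM (b * k.+1%:R)%R b.
have -> : (b * k.+1%:R + b = b * k.+2%:R)%R by rewrite -[in RHS]natr1 mulrDr mulr1.
move=> gE.
rewrite ltey; apply/eqP => gy; move: gE.
rewrite gy gt0_muley ?ebeta_gt0// => gE.
suff : egamma (b * k.+1%:R)%R * egamma b < +oo by rewrite gE ltxx.
rewrite lte_mul_pinfty ?egamma_lty_le1 ?b0//; first exact/ltW/egamma_gt0.
by rewrite ge0_fin_numE//; exact/ltW/egamma_gt0.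
Qed.

Lemma Gamma_gt0 (a : R) : (0 < a)%R -> (0 < Gamma a)%R.
Proof. by move=> a0; rewrite GammaE fine_gt0// egamma_gt0 egamma_lty. Qed.

Lemma EFin_Gamma (a : R) : (0 < a)%R -> (Gamma a)%:E = egamma a.
Proof.
by move=> a0; rewrite GammaE fineK// ge0_fin_numE ?egamma_lty// ltW ?egamma_gt0.
Qed.

Lemma Gamma1 : @Gamma R 1%R = 1%R.
Proof. by rewrite GammaE egamma1. Qed.

Lemma Gamma2 : @Gamma R 2%R = 1%R.
Proof. by rewrite GammaE egamma2. Qed.



End gamma.

(** * Fractional kernels and fractional integrals of causal functions *)

Section nker.
Local Open Scope ereal_scope.
Context {R : realType}.
Local Notation mu := (@lebesgue_measure R).
Implicit Types (a b c t x : R) (h u v : R -> R).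

Definition nker a x : R := (pker a x / Gamma a)%R.

Local Notation K a := (EFin \o nker a).

Lemma nker_ge0 a x : (0 < a)%R -> (0 <= nker a x)%R.
Proof. by move=> a0; rewrite divr_ge0 ?pker_ge0// ltW// Gamma_gt0. Qed.

Lemma nker_le0 a x : (x <= 0)%R -> nker a x = 0%R.
Proof. by move=> x0; rewrite /nker pker_le0// mul0r. Qed.

Lemma nker_gt0E a x : (0 < x)%R -> nker a x = (x `^ (a - 1) / Gamma a)%R.
Proof. by move=> x0; rewrite /nker /pker x0. Qed.

Lemma measurable_nker a : measurable_fun [set: R] (nker a).
Proof. by apply: measurable_funM => //; exact: measurable_pker. Qed.

Let mK a : measurable_fun [set: R] (K a).
Proof. by apply/measurable_EFinP; exact: measurable_nker. Qed.

Let K0 a : (0 < a)%R -> forall x, 0 <= K a x.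
Proof. by move=> a0 x; rewrite lee_fin nker_ge0. Qed.

(** By [egammaM] the Beta factor is Gamma(a) Gamma(b) / Gamma(a+b), which exchanges the two
    normalisations for that of index a + b. *)
Lemma conv_nker a b t : (0 < a)%R -> (0 < b)%R -> conv (K a) (K b) t = K (a + b)%R t.
Proof.
move=> a0 b0; have ab0 : (0 < a + b)%R by exact: addr_gt0.
have Ga := Gamma_gt0 a0; have Gb := Gamma_gt0 b0; have Gab := Gamma_gt0 ab0.
have betaE : ebeta a b = (Gamma a * Gamma b / Gamma (a + b))%:E.
  have := egammaM a b; rewrite -!EFin_Gamma// -EFinM => GG.
  by rewrite EFinM GG -muleA -EFinM mulfV ?mule1// gt_eqF.
transitivity (((Gamma a)^-1 / Gamma b)%:E *
    conv (EFin \o pker a) (EFin \o pker b) t).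
  rewrite /conv -ge0_integralZl//; first last.
  - by rewrite lee_fin ltW// divr_gt0// invr_gt0.
  - by move=> s _; rewrite lee_fin mulr_ge0// pker_ge0.
  - apply: measurable_conv1; apply/measurable_EFinP; exact: measurable_pker.
  apply: eq_integral => s _; rewrite /= -!EFinM /nker; congr EFin; ring.
rewrite conv_pker betaE /= -!EFinM /nker; congr EFin.
by field; rewrite (lt0r_neq0 Ga) (lt0r_neq0 Gb) (lt0r_neq0 Gab).
Qed.

Lemma nker2 x : (0 <= x)%R -> nker 2 x = x.
Proof.
move=> x0; have [->|xn0] := eqVneq x 0%R; first by rewrite nker_le0.
rewrite nker_gt0E ?lt_neqAle 1?eq_sym ?xn0// Gamma2 divr1.
by rewrite (_ : 2 - 1 = 1)%R ?powRr1//; ring.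
Qed.

(** Excluding b = 0 matters at x = 0, where 0^0 is 1 but the kernel vanishes. *)
Lemma powR_nker b x : (0 <= x)%R -> b != 0%R ->
  (x `^ b / Gamma (b + 1))%R = nker (b + 1) x.
Proof.
move=> x0 b0; have [->|xn0] := eqVneq x 0%R.
  by rewrite powR0// mul0r nker_le0.
by rewrite nker_gt0E ?lt_neqAle 1?eq_sym ?xn0// addrK.
Qed.

(** Nonnegativity gives access to Tonelli, and a bound to the left of each t makes the fractional
    integrals finite. *)
Definition causal h := [/\ measurable_fun [set: R] h, forall x, (0 <= h x)%R,
  forall x, (x <= 0)%R -> h x = 0%R &
  forall t, exists M, forall x, (x <= t)%R -> (h x <= M)%R].

Definition fracint b h t : R := fine (conv (K b) (EFin \o h) t).

(** [nker 1] is the Heaviside function; its fractional integrals are the kernels of index above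
    1. *)
Lemma causal_nker1 : causal (nker 1).
Proof.
split.
- exact: measurable_nker.
- by move=> x; exact: nker_ge0.
- exact: nker_le0.
- move=> t; exists 1%R => x _; have [x0|x0] := leP x 0%R.
    by rewrite nker_le0.
  by rewrite nker_gt0E// subrr powRr0 Gamma1 invr1 mulr1.
Qed.

Section causal_theory.
Variables (h : R -> R) (sh : causal h).

Let mh : measurable_fun [set: R] (EFin \o h).
Proof. by case: sh => mh *; exact/measurable_EFinP. Qed.

Let h0 x : 0 <= (EFin \o h) x.
Proof. by case: sh => _ h0 *; rewrite lee_fin. Qed.

(** If h <= M up to t, comparison with M k_1 bounds the value by M k_(b+1)(t). *)
Lemma conv_nker_fin b t : (0 < b)%R -> conv (K b) (EFin \o h) t \is a fin_num.
Proof.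
move=> b0; rewrite ge0_fin_numE; last by apply: conv_ge0 => //; exact: K0.
have [_ hpos hle0 /(_ t) [M hM]] := sh.
have M0 : (0 <= M)%R by rewrite (le_trans (hpos t))// hM.
apply: (@le_lt_trans _ _ (M%:E * conv (K b) (K 1%R) t)); last first.
  by rewrite conv_nker//= -EFinM ltry.
rewrite /conv -ge0_integralZl//; first last.
- by move=> s _; rewrite mule_ge0// K0.
- exact: measurable_conv1.
apply: ge0_le_integral => //.
- by move=> s _; rewrite mule_ge0// K0.
- exact: measurable_conv1.
- by apply: measurable_funeM; exact: measurable_conv1.
- move=> s _; rewrite /= -!EFinM lee_fin.
  have [s0|s0] := leP s 0%R; first by rewrite hle0// (nker_le0 1%R)// !mulr0.
  have [ts|st] := leP t s; first by rewrite (nker_le0 b) ?subr_le0// !mul0r mulr0.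
  rewrite (nker_gt0E 1%R)// subrr powRr0 Gamma1 invr1 !mulr1 mulrC.
  by rewrite ler_wpM2r ?nker_ge0// hM// ltW.
Qed.

Lemma EFin_fracint b t : (0 < b)%R ->
  (fracint b h t)%:E = conv (K b) (EFin \o h) t.
Proof. by move=> b0; rewrite /fracint fineK// conv_nker_fin. Qed.

Lemma fracint_ge0 b t : (0 < b)%R -> (0 <= fracint b h t)%R.
Proof.
by move=> b0; rewrite -lee_fin EFin_fracint//; apply: conv_ge0 => //; exact: K0.
Qed.

Lemma fracint_le0 b t : (t <= 0)%R -> fracint b h t = 0%R.
Proof.
move=> t0; rewrite /fracint /conv integral0_eq// => s _.
have [_ _ hle0 _] := sh.
have [s0|s0] := leP s 0%R; first by rewrite /= hle0// mule0.
by rewrite /= nker_le0 ?mul0e// subr_le0 (le_trans t0)// ltW.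
Qed.

Lemma measurable_fracint b : (0 < b)%R -> measurable_fun [set: R] (fracint b h).
Proof.
move=> b0; apply/measurable_EFinP.
rewrite (_ : _ \o _ = conv (K b) (EFin \o h)); last first.
  by apply/funext => t; rewrite /= EFin_fracint.
by apply: measurable_conv => //; exact: K0.
Qed.

Lemma conv_fracint_shift a b c t : (0 < a)%R -> (0 < b)%R ->
  conv (K a) (fun s => (fracint b h (s - c))%:E) t =
  (fracint (a + b) h (t - c))%:E.
Proof.
move=> a0 b0; apply: (etrans _ (esym (EFin_fracint (t - c) (addr_gt0 a0 b0)))).
have -> : (fun s => (fracint b h (s - c))%:E) =
    (fun s => conv (K b) (EFin \o h) (s - c)%R).
  by apply/funext => s; exact: EFin_fracint.
have -> : K (a + b)%R = conv (K a) (K b).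
  by apply/funext => s; rewrite conv_nker.
have mKh : measurable_fun [set: R] (conv (K b) (EFin \o h)).
  exact: (measurable_conv (mK b) mh (K0 b0) h0).
rewrite -(convA (t - c) (mK a) (mK b) mh (K0 a0) (K0 b0) h0).
exact: (conv_shift (mK a) mKh (K0 a0) (conv_ge0 (K0 b0) h0) c t).
Qed.

End causal_theory.

Lemma fracint_nker a b t : (0 < a)%R -> (0 < b)%R ->
  fracint a (nker b) t = nker (a + b) t.
Proof. by move=> a0 b0; rewrite /fracint conv_nker. Qed.

(** Endpoints are null, so agreement on the open interval is enough; v can then vanish at 0 where u
    does not. This links integrals over [0, t] to convolutions. *)
Lemma RL_integrandE a u v t : (0 < a)%R ->
  measurable_fun [set: R] u -> measurable_fun [set: R] v ->
  (forall x, (0 <= v x)%R) -> (forall x, (x <= 0)%R -> v x = 0%R) ->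
  (forall s, (0 < s < t)%R -> u s = v s) ->
  \int[mu]_(r in `[0%R, t]) ((t - r) `^ (a - 1) * u r)%:E =
  (Gamma a)%:E * conv (K a) (EFin \o v) t.
Proof.
move=> a0 mfu mfv v0 vle0 uv; have Ga := Gamma_gt0 a0.
have mtr : measurable_fun [set: R] (fun r => (t - r) `^ (a - 1))%R.
  by apply: (measurableT_comp (measurable_powR _)); exact: measurable_fun_subr.
rewrite integral_itv_bndoo; last first.
  by apply/measurable_EFinP/measurable_funTS/measurable_funM.
rewrite /conv -ge0_integralZl//; first last.
- by rewrite lee_fin ltW.
- by move=> s _; rewrite mule_ge0 ?lee_fin ?v0// nker_ge0.
- by apply: measurable_conv1 => //; exact/measurable_EFinP.
rewrite [LHS]integral_mkcond; apply: eq_integral => s _.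
rewrite patchE mem_setE in_itv/= -!EFinM.
have [s0|s0]/= := leP s 0%R; first by rewrite vle0// !mulr0.
have [ts|st]/= := leP t s; first by rewrite nker_le0 ?subr_le0// mul0r mulr0.
rewrite uv ?s0// nker_gt0E ?subr_gt0//; congr EFin.
by field; rewrite gt_eqF.
Qed.

Definition RLreal a u t : R :=
  ((Gamma a)^-1 * \int[mu]_(r in `[0%R, t]) ((t - r) `^ (a - 1) * u r))%R.

Definition RLintegrable a u t :=
  mu.-integrable `[0%R, t] (fun r => ((t - r) `^ (a - 1) * u r)%:E).

Lemma measurable_RL a u t : measurable_fun [set: R] u ->
  measurable_fun [set: R] (fun r => (t - r) `^ (a - 1) * u r)%R.
Proof.
move=> mfu; apply: measurable_funM => //.
by apply: (measurableT_comp (measurable_powR _)); exact: measurable_fun_subr.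
Qed.

Lemma RLintegrableP a u v t : (0 < a)%R ->
  measurable_fun [set: R] u -> measurable_fun [set: R] v ->
  (forall x, (0 <= v x)%R) -> (forall x, (x <= 0)%R -> v x = 0%R) ->
  (forall s, (0 < s < t)%R -> u s = v s) ->
  conv (K a) (EFin \o v) t \is a fin_num -> RLintegrable a u t.
Proof.
move=> a0 mfu mfv v0 vle0 uv vfin.
apply/integrableP; split.
  by apply/measurable_EFinP/measurable_funTS; exact: measurable_RL.
have -> : \int[mu]_(r in `[0%R, t]) `|((t - r) `^ (a - 1) * u r)%:E| =
    \int[mu]_(r in `[0%R, t]) ((t - r) `^ (a - 1) * `|u r|)%:E.
  by apply: eq_integral => r _; rewrite /= normrM ger0_norm// powR_ge0.
rewrite (@RL_integrandE _ _ v)//.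
- by rewrite -(fineK vfin) -EFinM ltry.
- exact: measurableT_comp.
- by move=> s /uv ->; rewrite ger0_norm.
Qed.

Lemma RLrealE a u v t : (0 < a)%R ->
  measurable_fun [set: R] u -> measurable_fun [set: R] v ->
  (forall x, (0 <= v x)%R) -> (forall x, (x <= 0)%R -> v x = 0%R) ->
  (forall s, (0 < s < t)%R -> u s = v s) ->
  RLreal a u t = fine (conv (K a) (EFin \o v) t).
Proof.
move=> a0 mfu mfv v0 vle0 uv.
rewrite /RLreal /Rintegral (@RL_integrandE _ _ v)//.
have Ga := Gamma_gt0 a0.
have : 0 <= conv (K a) (EFin \o v) t.
  by apply: conv_ge0 => x; rewrite lee_fin// nker_ge0.
(* In the infinite case both sides are 0, the value of [fine] at [+oo]. *)
case: (conv _ _ _) => [r| |]//= _; first by rewrite mulKf// gt_eqF.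
by rewrite gt0_muley ?lte_fin//= mulr0.
Qed.

Lemma RLreal_fracint a b c h t : (0 < a)%R -> (0 < b)%R -> (0 <= c)%R ->
  causal h ->
  RLintegrable a (fun r => fracint b h (r - c)) t /\
  RLreal a (fun r => fracint b h (r - c)) t = fracint (a + b) h (t - c).
Proof.
move=> a0 b0 c0 sh; set v := fun r => _.
have mv : measurable_fun [set: R] v.
  apply: measurableT_comp; first exact: measurable_fracint.
  exact: measurable_funB.
have v0 x : (0 <= v x)%R by exact: fracint_ge0.
have vle0 x : (x <= 0)%R -> v x = 0%R.
  by move=> x0; rewrite /v fracint_le0// subr_le0 (le_trans x0).
split.
  apply: (@RLintegrableP _ _ v) => //.
  by rewrite conv_fracint_shift.
by rewrite (@RLrealE _ _ v)// conv_fracint_shift.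
Qed.

Lemma RLreal_causal a h u t : (0 < a)%R -> measurable_fun [set: R] u ->
  causal h -> (forall s, (0 < s < t)%R -> u s = h s) ->
  RLintegrable a u t /\ RLreal a u t = fracint a h t.
Proof.
move=> a0 mfu sh uh; have [mfh h0 hle0 _] := sh; split.
  by apply: (@RLintegrableP _ _ h) => //; exact: conv_nker_fin.
by rewrite (@RLrealE _ _ h).
Qed.

End nker.

(** * Continuity of kernels and of fractional integrals *)

Section continuity.
Local Open Scope ereal_scope.
Context {R : realType}.
Local Notation mu := (@lebesgue_measure R).
Implicit Types (a b c t x : R) (h u v : R -> R).

Local Notation K a := (EFin \o nker a).

(** The exponent b - 1 is positive, so the power tends to 0 from the right and joins the zero
    half-line continuously. *)
Lemma continuous_nker b : (1 < b)%R -> continuous (nker b : R -> R).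
Proof.
move=> b1; have p0 : (0 < b - 1)%R by rewrite subr_gt0.
suff cp : continuous (pker b : R -> R).
  by move=> x; apply: cvgM; [exact: cp|exact: cvg_cst].
move=> x; have [x0|x0|x0] := ltgtP x 0%R.
- rewrite /continuous_at pker_le0 ?ltW//.
  apply: cvg_near_cst.
  near=> y; rewrite pker_le0// ltW//; near: y; exact: lt_nbhsl.
- have : {for x, continuous (fun y => y `^ (b - 1))%R}.
    by apply/differentiable_continuous/derivable1_diffP/derivable_powR;
      rewrite in_itv/= andbT.
  rewrite /continuous_at /= {2}/pker x0; apply: cvg_trans; apply: near_eq_cvg.
  near=> y; rewrite /pker ifT//; near: y; exact: lt_nbhsr.
- rewrite x0; apply/left_right_continuousP; rewrite pker_le0//; split.
    apply: cvg_near_cst.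
    by near=> y; rewrite pker_le0.
  apply: cvg_trans (powR_cvg0 p0); apply: near_eq_cvg.
  by near=> y; rewrite /pker ifT.
Unshelve. all: end_near. Qed.

(** The integral over ]0, T[ is the convolution of k_1 and k_b at T, that is k_(b+1)(T). *)
Lemma nker_integrable b T : (0 < b)%R ->
  mu.-integrable `]0%R, T[ (EFin \o (nker b : R -> R)).
Proof.
move=> b0; apply/integrableP; split.
  by apply/measurable_EFinP/measurable_funTS; exact: measurable_nker.
have : conv (K 1%R) (K b) T < +oo by rewrite conv_nker//= ltry.
congr (_ < _); rewrite [RHS]integral_mkcond; apply: eq_integral => s _.
rewrite patchE mem_setE in_itv/= [point]/(0 : \bar R) -EFinM.
have [s0|s0]/= := leP s 0%R; first by rewrite (nker_le0 b)// mulr0.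
have [Ts|sT]/= := leP T s; first by rewrite nker_le0 ?subr_le0// mul0r.
rewrite (nker_gt0E 1%R) ?subr_gt0// subrr powRr0 Gamma1 invr1 !mul1r.
by rewrite ger0_norm// nker_ge0.
Qed.

(** Commutativity moves t into the continuous factor h. As h is causal, the domain can be fixed as
    ]0, T[ for all t < T, and M k_b dominates the integrand there, M being a bound of h up to T. *)
Lemma continuous_fracint b h : (0 < b)%R -> causal h -> continuous h ->
  continuous (fracint b h).
Proof.
move=> b0 sh ch t0; set T := (t0 + 1)%R.
have [mh h0 hle0 hM] := sh.
pose F t := (\int[mu]_(s in `]0%R, T[) (h (t - s) * nker b s))%R.
have fE t : (t < T)%R -> fracint b h t = F t.
  move=> tT; rewrite /fracint convC; last 4 first.
  - by apply/measurable_EFinP; exact: measurable_nker.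
  - exact/measurable_EFinP.
  - by move=> x; rewrite lee_fin nker_ge0.
  - by move=> x; rewrite lee_fin.
  rewrite /F /Rintegral; congr fine; rewrite [RHS]integral_mkcond.
  apply: eq_integral => s _; rewrite patchE mem_setE in_itv/= -EFinM.
  have [s0|s0]/= := leP s 0%R; first by rewrite nker_le0// mulr0.
  have [Ts|sT]//= := leP T s; rewrite hle0 ?mul0r// subr_le0.
  by rewrite (le_trans (ltW tT)).
have [M MT] := hM T.
have M0 : (0 <= M)%R by rewrite (le_trans (h0 T))// MT.
have hTM t s : (t < T)%R -> (0 < s)%R -> (h (t - s) <= M)%R.
  by move=> tT s0; apply: MT; rewrite lerBlDr (le_trans (ltW tT))// lerDl ltW.
have iM : mu.-integrable `]0%R, T[ (EFin \o (fun s => M * nker b s)%R).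
  rewrite (_ : _ \o _ = fun s => M%:E * (EFin \o nker b) s)//.
  by apply: integrableZl => //; exact: nker_integrable.
have mF t : measurable_fun [set: R] (fun s => h (t - s) * nker b s)%R.
  apply: measurable_funM; last exact: measurable_nker.
  by apply: measurableT_comp => //; exact: measurable_fun_subr.
have bnd t s : (t < T)%R -> (0 < s)%R -> (`|h (t - s) * nker b s| <= M * nker b s)%R.
  move=> tT s0; rewrite ger0_norm; last by rewrite mulr_ge0 ?h0 ?nker_ge0.
  by rewrite ler_wpM2r ?nker_ge0// hTM.
have cF : {for t0, continuous F}.
  have := @continuity_under_integral R _ _ mu (fun t s => h (t - s) * nker b s)%R
    `]0%R, T[%classic (measurable_itv _) (t0 - 1)%R T _ _ (fun s => M * nker b s)%R iM.
  apply.
  - move=> t /=; rewrite in_itv/= => /andP[_ tT].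
    apply: le_integrable iM => //.
    + by apply/measurable_EFinP/measurable_funTS; exact: mF.
    + move=> s /=; rewrite in_itv/= => /andP[s0 _].
      rewrite lee_fin; apply: le_trans (ler_norm _); exact: bnd.
  - apply: aeW => s _ t _; apply: cvgM; last exact: cvg_cst.
    apply: (@continuous_comp _ _ _ (fun t => t - s)%R h); last exact: ch.
    by apply: cvgB; [exact: cvg_id|exact: cvg_cst].
  - move=> t /=; rewrite in_itv/= => /andP[_ tT].
    by apply: aeW => s /=; rewrite in_itv/= => /andP[s0 _]; exact: bnd.
  - by rewrite inE/= in_itv/= /T; apply/andP; split; lra.
have t0T : (t0 < T)%R by rewrite /T ltrDl.
rewrite /continuous_at fE//; apply: cvg_trans cF; apply: near_eq_cvg.
near=> t; rewrite fE//; near: t; exact: lt_nbhsl.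
Unshelve. all: end_near. Qed.

End continuity.

(** * Linearity of fractional integrals, real and complex *)

Section fractional_values.
Context {R : realType}.
Local Notation mu := (@lebesgue_measure R).
Implicit Types (a b c t x k l w z : R) (h u v : R -> R).

(** Integrability travels with the value, since linearity of the integral on signed functions
    depends on it. *)
Definition RLval a u t w := RLintegrable a u t /\ RLreal a u t = w.

Lemma RLval_lin a t u v k l w z : RLval a u t w -> RLval a v t z ->
  RLval a (fun r => k * u r + l * v r) t (k * w + l * z).
Proof.
move=> [iu <-] [iv <-].
have iku : RLintegrable a (fun r => k * u r) t.
  rewrite /RLintegrable.
  rewrite (_ : (fun r => _) = (fun r => k%:E * ((t - r) `^ (a - 1) * u r)%:E)%E).
    exact: integrableZl.
  by apply/funext => r; rewrite -EFinM mulrCA.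
have ilv : RLintegrable a (fun r => l * v r) t.
  rewrite /RLintegrable.
  rewrite (_ : (fun r => _) = (fun r => l%:E * ((t - r) `^ (a - 1) * v r)%:E)%E).
    exact: integrableZl.
  by apply/funext => r; rewrite -EFinM mulrCA.
split.
  rewrite /RLintegrable.
  rewrite (_ : (fun r => _) = (fun r => ((t - r) `^ (a - 1) * (k * u r))%:E +
      ((t - r) `^ (a - 1) * (l * v r))%:E)%E).
    exact: integrableD.
  by apply/funext => r; rewrite -EFinD mulrDr.
rewrite /RLreal.
under eq_Rintegral do rewrite mulrDr.
rewrite RintegralD//.
under eq_Rintegral do rewrite mulrCA.
rewrite RintegralZl//.
under [X in _ * (_ + X)]eq_Rintegral do rewrite mulrCA.
rewrite RintegralZl//; ring.
Qed.

Lemma RLval0 a t : RLval a (fun=> 0) t 0.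
Proof.
split.
  rewrite /RLintegrable (_ : (fun r => _) = cst 0%E); first exact: integrable0.
  by apply/funext => r; rewrite mulr0.
rewrite /RLreal; under eq_Rintegral do rewrite mulr0.
by rewrite Rintegral_cst//= mul0r mulr0.
Qed.

Lemma RLval_fracint a b c h t : 0 < a -> 0 < b -> 0 <= c -> causal h ->
  RLval a (fun r => fracint b h (r - c)) t (fracint (a + b) h (t - c)).
Proof. by move=> a0 b0 c0 sh; exact: RLreal_fracint. Qed.

(** As b > 1, k_b is the integral of order b - 1 of the Heaviside function, so this is an instance
    of the causal case. *)
Lemma RLval_nker a b c t : 0 < a -> 1 < b -> 0 <= c ->
  RLval a (fun r => nker b (r - c)) t (nker (a + b) (t - c)).
Proof.
move=> a0 b1 c0; have b0 : 0 < b - 1 by rewrite subr_gt0.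
have -> : (fun r => nker b (r - c)) = (fun r => fracint (b - 1) (nker 1) (r - c)).
  by apply/funext => r; rewrite fracint_nker// subrK.
have -> : nker (a + b) (t - c) = fracint (a + (b - 1)) (nker 1) (t - c).
  rewrite fracint_nker//; last exact: addr_gt0.
  by congr nker; ring.
exact: RLval_fracint causal_nker1.
Qed.

Definition CRLval a (u : R -> R[i]) t (w : R[i]) :=
  RLval a (fun r => complex.Re (u r)) t (complex.Re w) /\
  RLval a (fun r => complex.Im (u r)) t (complex.Im w).

(** The kernel is real, so it acts on real and imaginary parts separately. *)
Lemma RLintE a (u : R -> R[i]) t (w : R[i]) : CRLval a u t w -> RLint a u t = w.
Proof.
move=> [[_ ru] [_ iu]]; rewrite /RLint /Cintegral.
under eq_Rintegral => r _.
  rewrite (_ : complex.Re _ = (t - r) `^ (a - 1) * complex.Re (u r)); last first.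
    by case: (u r) => x y /=; rewrite mul0r subr0.
  over.
under [X in _ +i* X]eq_Rintegral => r _.
  rewrite (_ : complex.Im _ = (t - r) `^ (a - 1) * complex.Im (u r)); last first.
    by case: (u r) => x y /=; rewrite mul0r addr0.
  over.
rewrite /RLreal in ru iu.
by case: w ru iu => x y /= <- <-; simpc.
Qed.

Lemma CRLval_real a u t w : RLval a u t w ->
  CRLval a (fun r => (u r)%:C) t w%:C.
Proof. by move=> uw; split => //=; exact: RLval0. Qed.

Lemma CRLvalD a (u v : R -> R[i]) t (w z : R[i]) :
  CRLval a u t w -> CRLval a v t z ->
  CRLval a (fun r => u r + v r) t (w + z).
Proof.
move=> [ur ui] [vr vi]; split.
  have := RLval_lin 1 1 ur vr; rewrite !mul1r -raddfD.
  by congr RLval; apply/funext => r; rewrite !mul1r -raddfD.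
have := RLval_lin 1 1 ui vi; rewrite !mul1r -raddfD.
by congr RLval; apply/funext => r; rewrite !mul1r -raddfD.
Qed.

Lemma CRLvalZ a (u : R -> R[i]) t (k w : R[i]) :
  CRLval a u t w -> CRLval a (fun r => k * u r) t (k * w).
Proof.
case: k => k l [ur ui]; split.
  have := RLval_lin k (- l) ur ui.
  congr RLval; first by apply/funext => r; case: (u r) => x y /=; rewrite mulNr.
  by case: (w) => x y /=; rewrite mulNr.
have := RLval_lin k l ui ur.
congr RLval; first by apply/funext => r; case: (u r).
by case: (w).
Qed.

Lemma CRLval_sum a t (I : Type) (s : seq I) (u : I -> R -> R[i]) (w : I -> R[i]) :
  (forall i, CRLval a (u i) t (w i)) ->
  CRLval a (fun r => \sum_(i <- s) u i r) t (\sum_(i <- s) w i).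
Proof.
move=> uw; elim: s => [|i s IH].
  rewrite big_nil (_ : (fun r => _) = fun=> 0%:C).
    exact/CRLval_real/RLval0.
  by apply/funext => r; rewrite big_nil.
rewrite big_cons (_ : (fun r => _) = fun r => u i r + \sum_(j <- s) u j r).
  exact: CRLvalD.
by apply/funext => r; rewrite big_cons.
Qed.

Lemma eq_RLint a (u v : R -> R[i]) t :
  (forall r, 0 <= r <= t -> u r = v r) -> RLint a u t = RLint a v t.
Proof.
move=> uv; rewrite /RLint /Cintegral.
by congr (_ * (_ +i* _)); apply: eq_Rintegral => r; rewrite inE/= in_itv/= => /uv ->.
Qed.

Lemma eq_RLreal a u v t :
  (forall r, 0 <= r <= t -> u r = v r) -> RLreal a u t = RLreal a v t.
Proof.
move=> uv; rewrite /RLreal.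
by congr (_ * _); apply: eq_Rintegral => r; rewrite inE/= in_itv/= => /uv ->.
Qed.

End fractional_values.

(** * Extension of f to the line and its splitting into causal functions *)

Section continuous_extension.
Context {R : realType}.
Variable f : R -> R.
Hypothesis f_cont : {within `[0, +oo[, continuous f}.

(** Freezing f at f(0) on the negative axis makes it continuous, hence measurable, on the whole
    line. *)
Definition extend0 (x : R) : R := f (Num.max x 0).

Lemma continuous_extend0 : continuous extend0.
Proof.
have [fc f0] := (continuous_within_itvcyP 0 f).1 f_cont.
move=> x; have [x0|x0|->] := ltgtP x 0.
- rewrite /continuous_at; apply: cvg_near_cst; near=> y.
  rewrite /extend0 !max_r ?ltW//; near: y; exact: lt_nbhsl.
- have : {for x, continuous f} by apply: fc; rewrite in_itv/= andbT.
  rewrite /continuous_at {2}/extend0 max_l ?ltW//.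
  apply: cvg_trans; apply: near_eq_cvg; near=> y.
  rewrite /extend0 max_l// ltW//; near: y; exact: lt_nbhsr.
- apply/left_right_continuousP; rewrite {2 4}/extend0 maxxx; split.
    apply: cvg_near_cst; near=> y; by rewrite /extend0 max_r.
  apply: cvg_trans f0; apply: near_eq_cvg; near=> y.
  rewrite /extend0 max_l//; near: y; exact: nbhs_right_ge.
Unshelve. all: end_near. Qed.

(** For e = 1 and e = -1 these are the positive and negative parts of f - f(0). Subtracting f(0)
    lets them vanish on the left and stay continuous. *)
Definition incr_part (e x : R) : R := Num.max (e * (extend0 x - extend0 0)) 0.

Lemma continuous_incr_part e : continuous (incr_part e).
Proof.
have ce : continuous (fun x => e * (extend0 x - extend0 0)).
  move=> x; apply: cvgM; first exact: cvg_cst.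
  by apply: cvgB; [exact: continuous_extend0|exact: cvg_cst].
move=> x; apply: (@continuous_max _ _ _ (cst 0) x (ce x)).
exact: cst_continuous.
Qed.

Lemma causal_incr_part e : causal (incr_part e).
Proof.
have le0 x : x <= 0 -> incr_part e x = 0.
  by move=> x0; rewrite /incr_part /extend0 !max_r ?subrr ?mulr0.
split.
- by apply: continuous_measurable_fun; exact: continuous_incr_part.
- by move=> x; rewrite le_max lexx orbT.
- exact: le0.
(* The bound comes from the extreme value theorem on [0, max(t, 0)], an interval that is nonempty
   for negative t too. *)
- move=> t; have t0 : 0 <= Num.max t 0 by rewrite le_max lexx orbT.
  have [|c _ hc] := @EVT_max R (incr_part e) _ _ t0.
    by apply: continuous_subspaceT; exact: continuous_incr_part.
  exists (incr_part e c) => x xt; have [x0|x0] := leP x 0.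
    by rewrite le0// le_max lexx orbT.
  by apply: hc; rewrite in_itv/= ltW//= le_max xt.
Qed.

Lemma extend0E x :
  extend0 x = extend0 0 + incr_part 1 x - incr_part (-1) x.
Proof.
rewrite /incr_part mul1r mulN1r opprB; set p := extend0 x; set q := extend0 0.
have [pq|pq] := leP p q.
  by rewrite max_r ?subr_le0// max_l ?subr_ge0//; lra.
by rewrite max_l ?subr_ge0 ?(ltW pq)// max_r ?subr_le0 ?(ltW pq)//; lra.
Qed.

(** This is J^b f for f split as f(0) plus its increasing part minus its decreasing part in the
    sense of [incr_part]; the constant contributes f(0) k_(b+1). *)
Definition fracint_extend (b t : R) : R :=
  extend0 0 * nker (b + 1) t + fracint b (incr_part 1) t
  - fracint b (incr_part (-1)) t.

Lemma fracint_extend_le0 b t : t <= 0 -> fracint_extend b t = 0.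
Proof.
move=> t0; rewrite /fracint_extend nker_le0// !fracint_le0//;
  try exact: causal_incr_part.
by rewrite mulr0 addr0 subrr.
Qed.

Lemma continuous_fracint_extend b : 0 < b -> continuous (fracint_extend b).
Proof.
move=> b0 x; apply: cvgB.
  apply: cvgD.
    apply: cvgM; first exact: cvg_cst.
    by apply: continuous_nker; rewrite ltrDr.
  by apply: continuous_fracint => //;
    [exact: causal_incr_part|exact: continuous_incr_part].
by apply: continuous_fracint => //; [exact: causal_incr_part|exact: continuous_incr_part].
Qed.

Lemma RLval_extend0 a t : 0 < a -> RLval a extend0 t (fracint_extend a t).
Proof.
move=> a0.
(* The constant 1 equals the Heaviside function [nker 1] on ]0, t[. *)
have r1 : RLval a (fun=> 1) t (nker (a + 1) t).
  rewrite -fracint_nker//; apply: RLreal_causal => //; first exact: causal_nker1.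
  by move=> s /andP[s0 _]; rewrite nker_gt0E// subrr powRr0 Gamma1 invr1 mulr1.
have rh e : RLval a (incr_part e) t (fracint a (incr_part e) t).
  apply: RLreal_causal => //; last exact: causal_incr_part.
  by have [] := causal_incr_part e.
have := RLval_lin 1 (-1) (RLval_lin (extend0 0) 1 r1 (rh 1)) (rh (-1)).
congr RLval.
  by apply/funext => r; rewrite [RHS]extend0E; ring.
by rewrite /fracint_extend; ring.
Qed.

Lemma RLval_fracint_extend a b c t : 0 < a -> 0 < b -> 0 <= c ->
  RLval a (fun r => fracint_extend b (r - c)) t (fracint_extend (a + b) (t - c)).
Proof.
move=> a0 b0 c0.
have r1 : RLval a (fun r => nker (b + 1) (r - c)) t (nker (a + b + 1) (t - c)).
  by rewrite -addrA; apply: RLval_nker => //; rewrite ltrDr.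
have rh e := RLval_fracint t a0 b0 c0 (causal_incr_part e).
have := RLval_lin 1 (-1) (RLval_lin (extend0 0) 1 r1 (rh 1)) (rh (-1)).
congr RLval; last by rewrite /fracint_extend; ring.
by apply/funext => r; rewrite /fracint_extend; ring.
Qed.

End continuous_extension.

(** * Continuity of complex-valued sums *)

Section complex_topology.
Context {R : realType}.

Lemma normc_real (x : R) : `|x%:C| = `|x|%:C.
Proof. by rewrite normc_def/= expr0n/= addr0 sqrtr_sqr. Qed.

Lemma continuous_scale_real (c : R[i]) (u : R -> R) (x : R) :
  {for x, continuous u} -> {for x, continuous (fun t => c * (u t)%:C : R[i]^o)}.
Proof.
move=> cu; apply/(@cvgrPdist_le _ R[i]^o) => e e0.
(* A positive element of [R[i]] has zero imaginary part. *)
have [e' e'0 ->] : exists2 e' : R, 0 < e' & e = e'%:C.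
  case: e e0 => e1 e2; rewrite ltcE/= => /andP[/eqP -> e10].
  by exists e1.
(* Adding 1 to |c| keeps the divisor positive when c = 0. *)
have d0 : 0 < e' / (Num.sqrt (complex.Re c ^+ 2 + complex.Im c ^+ 2) + 1).
  by rewrite divr_gt0// ltr_wpDl// sqrtr_ge0.
have cnE : `|c| = (Num.sqrt (complex.Re c ^+ 2 + complex.Im c ^+ 2))%:C.
  by case: (c) => c1 c2.
move/cvgrPdist_le : cu => /(_ _ d0); apply: filterS => t.
rewrite ler_pdivlMr; last by rewrite ltr_wpDl// sqrtr_ge0.
move=> ut; rewrite -mulrBr -raddfB normrM/= normc_real cnE -rmorphM/= lecR.
by apply: le_trans ut; rewrite mulrC ler_wpM2l// lerDl.
Qed.

Lemma continuous_sum_complex (I : Type) (s : seq I) (u : I -> R -> R[i]^o) (x : R) :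
  (forall i, {for x, continuous (u i)}) ->
  {for x, continuous (fun t => \sum_(i <- s) u i t : R[i]^o)}.
Proof.
move=> cu; elim: s => [|i s IH].
  rewrite (_ : (fun t => _) = cst 0); first exact: cst_continuous.
  by apply/funext => t; rewrite big_nil.
rewrite (_ : (fun t => _) = fun t => u i t + \sum_(j <- s) u j t); last first.
  by apply/funext => t; rewrite big_cons.
exact: (cvgD (cu i) IH).
Qed.

End complex_topology.

(** * The delay equation: uniqueness, the series solution and its closed form *)

Section delay_equation.
Context {R : realType}.
Variables (alpha tau : R) (lambda : R[i]) (f : R -> R) (y0 : R).
Hypotheses (alpha_gt0 : 0 < alpha) (tau_gt0 : 0 < tau).

(** Method of steps: for 0 <= r <= (n+1) tau the delayed argument r - tau lies in [-tau, n tau], so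
    the induction hypothesis equates the two integrands. *)
Lemma delay_solution_uniq (phi : R -> R) (y z : R -> R[i]) :
  is_delay_solution alpha tau lambda f phi y ->
  is_delay_solution alpha tau lambda f phi z ->
  forall t, - tau <= t -> y t = z t.
Proof.
move=> [_ yphi yeq] [_ zphi zeq].
have steps (n : nat) : forall t, - tau <= t <= n%:R * tau -> y t = z t.
  elim: n => [|n IH] t /andP[tau_t t_n].
    by rewrite yphi ?zphi// tau_t; move: t_n; rewrite mul0r.
  have [t0|/ltW t0] := leP t 0; first by rewrite yphi ?zphi// tau_t.
  rewrite yeq// zeq//; congr (_ + _); apply: eq_RLint => r /andP[r0 rt].
  rewrite IH//; apply/andP; split; first by rewrite lerBrDr addNr.
  by rewrite lerBlDr (le_trans rt)// (le_trans t_n)// -natr1 mulrDl mul1r.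
move=> t tau_t; apply: (steps (Num.truncn (t / tau)).+1).
by rewrite tau_t -ler_pdivrMr// ltW// Num.Theory.truncnS_gt.
Qed.

Hypothesis f_cont : {within `[0, +oo[, continuous f}.

(** The coefficient of lambda^k in the closed formula. Written with causal kernels it makes sense on
    the whole line and vanishes for t <= (k-1) tau, which does the work of the floor. *)
Definition step_term (k : nat) (t : R) : R :=
  y0 / tau * (nker (alpha * k%:R + 2) (t + tau - k%:R * tau)
              - nker (alpha * k%:R + 2) (t - k%:R * tau))
  + fracint_extend f (alpha * k%:R + alpha) (t - k%:R * tau).

Definition step_sum (n : nat) (t : R) : R[i] :=
  \sum_(0 <= k < n) lambda ^+ k * (step_term k t)%:C.

(** For t >= 0 the indices run up to floor(t/tau) + 1, as in the longer sum of the formula. For t <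
    0 the absolute value in [delay_index] can only add vanishing terms. *)
Definition step_solution (t : R) : R[i] :=
  step_sum (delay_index tau t).+2 t.

Let ak_ge0 (k : nat) : 0 <= alpha * k%:R.
Proof. by rewrite mulr_ge0// ltW. Qed.

Lemma step_term_eq0 k t : t + tau <= k%:R * tau -> step_term k t = 0.
Proof.
move=> tk; have tk' : t <= k%:R * tau by rewrite (le_trans _ tk)// lerDl ltW.
rewrite /step_term !nker_le0 ?subr_le0// fracint_extend_le0 ?subr_le0//.
by rewrite subrr mulr0 addr0.
Qed.

Lemma step_sum_stable m n t : (m <= n)%N -> t + tau <= m%:R * tau ->
  step_sum n t = step_sum m t.
Proof.
move=> mn tm; rewrite /step_sum (big_cat_nat (leq0n m) mn)/=.
rewrite [X in _ + X]big_nat_cond [X in _ + X]big1 ?addr0// => k.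
rewrite andbT => /andP[mk _]; rewrite step_term_eq0 ?mulr0//.
by rewrite (le_trans tm)// ler_pM2r// ler_nat.
Qed.

(** True for negative t as well, because the absolute value of the floor is at least the floor. *)
Lemma delay_index_gt t : t < (delay_index tau t).+1%:R * tau.
Proof.
rewrite -ltr_pdivrMr//; apply: lt_le_trans (floorD1_gt _) _.
rewrite /delay_index -natr1 intrD lerD2r.
by rewrite -[leRHS]/((`|Num.floor (t / tau)|%N : int)%:~R) ler_int abszE ler_norm.
Qed.

(** Frees the number of terms from t: one finite sum represents the solution on all of ]-oo, (n-1)
    tau]. *)
Lemma step_solutionE n t : t + tau <= n%:R * tau ->
  step_solution t = step_sum n t.
Proof.
move=> tn; have ti : t + tau <= (delay_index tau t).+2%:R * tau.
  by rewrite -natr1 mulrDl mul1r lerD2r ltW// delay_index_gt.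
rewrite /step_solution -(step_sum_stable (leq_maxl _ n) ti).
by rewrite -(step_sum_stable (leq_maxr (delay_index tau t).+2 n) tn).
Qed.

(** The delay turns each shift k tau into (k+1) tau, and integration adds alpha to each index. After
    the delay even the kernel advanced by tau has a nonnegative shift, as [RLval_nker] demands. *)
Lemma RLval_step_term k t :
  RLval alpha (fun r => step_term k (r - tau)) t (step_term k.+1 t).
Proof.
have kt : 0 <= k%:R * tau by rewrite mulr_ge0// ltW.
have k1t : 0 <= k.+1%:R * tau by rewrite mulr_ge0// ltW.
have b1 : 1 < alpha * k%:R + 2 by have := ak_ge0 k; lra.
have b2 : 0 < alpha * k%:R + alpha by exact: ltr_wpDl.
have := RLval_lin (y0 / tau) 1
  (RLval_lin 1 (-1) (RLval_nker t alpha_gt0 b1 kt) (RLval_nker t alpha_gt0 b1 k1t))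
  (RLval_fracint_extend f_cont t alpha_gt0 b2 k1t).
congr RLval.
  apply/funext => r; rewrite /step_term.
  rewrite (_ : r - tau + tau = r); last by ring.
  rewrite (_ : r - tau - k%:R * tau = r - k.+1%:R * tau); first by ring.
  by rewrite -natr1; ring.
rewrite /step_term.
rewrite (_ : t + tau - k.+1%:R * tau = t - k%:R * tau);
  last by rewrite -natr1; ring.
rewrite (_ : alpha * k.+1%:R + 2 = alpha + (alpha * k%:R + 2));
  last by rewrite -natr1; ring.
rewrite (_ : alpha * k.+1%:R + alpha = alpha + (alpha * k%:R + alpha));
  last by rewrite -natr1; ring.
ring.
Qed.

(** Only the ramp k_2(t + tau) = t + tau is nonzero before time 0, and it reproduces the history. *)
Lemma step_term0_nonpos t : - tau <= t <= 0 ->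
  step_term 0 t = (t / tau + 1) * y0.
Proof.
move=> /andP[tt t0]; rewrite /step_term mulr0 !mul0r !subr0 !add0r.
rewrite fracint_extend_le0// (nker_le0 2 t0) nker2; last by lra.
by field; rewrite gt_eqF.
Qed.

(** After time 0 the two ramps differ by the constant tau, which leaves y0. *)
Lemma step_term0_nonneg t : 0 <= t ->
  step_term 0 t = y0 + fracint_extend f alpha t.
Proof.
move=> t0; rewrite /step_term mulr0 !mul0r !subr0 !add0r.
rewrite !nker2//; last by rewrite addr_ge0// ltW.
by field; rewrite gt_eqF.
Qed.

Lemma step_solution_history t : - tau <= t <= 0 ->
  step_solution t = ((t / tau + 1) * y0)%:C.
Proof.
move=> tt; have /andP[_ t0] := tt.
rewrite (@step_solutionE 1); last by rewrite mul1r gerDr.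
by rewrite /step_sum big_nat1 expr0 mul1r step_term0_nonpos.
Qed.

Lemma step_solution_eq t : 0 <= t ->
  step_solution t = y0%:C +
    RLint alpha (fun r => lambda * step_solution (r - tau) + (f r)%:C) t.
Proof.
move=> t0; set n := (delay_index tau t).+1.
have tn : t <= n%:R * tau by rewrite ltW// delay_index_gt.
rewrite (@step_solutionE n.+1); last by rewrite -natr1 mulrDl mul1r lerD2r.
(* The term k = 0 supplies y0 and the integral of f; the terms k + 1 must be the integrals of the
   delayed terms k. *)
rewrite /step_sum big_nat_recl// expr0 mul1r.
have tE : (step_term 0 t)%:C = y0%:C + (fracint_extend f alpha t)%:C.
  rewrite step_term0_nonneg//.
  exact: rmorphD.
rewrite [X in X + _ = _]tE -[LHS]addrA.
apply: (congr1 (+%R y0%:C)); apply/esym.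
rewrite [RHS]addrC.
(* For r in [0, t] the same n terms suffice at r - tau, so the integrand becomes a fixed finite sum
   to which linearity applies. *)
pose u r := lambda * step_sum n (r - tau) + (extend0 f r)%:C.
have uE r : 0 <= r <= t -> lambda * step_solution (r - tau) + (f r)%:C = u r.
  move=> /andP[r0 rt].
  have -> : step_solution (r - tau) = step_sum n (r - tau).
    by apply: step_solutionE; rewrite subrK (le_trans rt).
  by rewrite /u /extend0 (max_l r0).
rewrite (eq_RLint _ uE).
apply: RLintE; apply: CRLvalD; last exact/CRLval_real/RLval_extend0.
rewrite (_ : (fun r => _) =
    fun r => \sum_(0 <= k < n) lambda ^+ k.+1 * (step_term k (r - tau))%:C).
  apply: CRLval_sum => k; apply/CRLvalZ/CRLval_real; exact: RLval_step_term.
apply/funext => r; rewrite /step_sum mulr_sumr.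
by apply: eq_bigr => k _; rewrite exprS mulrA.
Qed.

Lemma continuous_step_term k : continuous (step_term k).
Proof.
have b1 : 1 < alpha * k%:R + 2 by have := ak_ge0 k; lra.
have b2 : 0 < alpha * k%:R + alpha by exact: ltr_wpDl.
have cs (c : R) g : continuous g -> continuous (fun t : R => g (t + c) : R).
  move=> cg x; apply: (@continuous_comp _ _ _ (fun t => t + c)%R g); last exact: cg.
  by apply: cvgD; [exact: cvg_id|exact: cvg_cst].
have cn := continuous_nker b1.
move=> x; rewrite /step_term; apply: cvgD.
  apply: cvgM; first exact: cvg_cst.
  apply: cvgB; last exact: (cs (- (k%:R * tau)) _ cn).
  exact: (cs tau _ (cs (- (k%:R * tau)) _ cn)).
exact: (cs (- (k%:R * tau)) _ (continuous_fracint_extend f_cont b2)).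
Qed.

Lemma continuous_step_solution : continuous (step_solution : R -> R[i]^o).
Proof.
(* This n satisfies t0 + tau < n tau strictly, so a single finite sum represents the solution near
   t0. *)
move=> t0; pose n := (delay_index tau t0).+2.
have tn : t0 < n%:R * tau - tau.
  by rewrite /n -natr1 mulrDl mul1r addrK delay_index_gt.
have cS : {for t0, continuous (step_sum n : R -> R[i]^o)}.
  apply: continuous_sum_complex => k; apply: continuous_scale_real.
  exact: continuous_step_term.
rewrite /continuous_at (@step_solutionE n); last by rewrite -lerBrDr ltW.
apply: cvg_trans cS; apply: near_eq_cvg; near=> t.
rewrite (@step_solutionE n)// -lerBrDr ltW//; near: t; exact: lt_nbhsl.
Unshelve. all: end_near. Qed.

Lemma step_solution_is_solution :
  is_delay_solution alpha tau lambda f (fun t => (t / tau + 1) * y0) step_solution.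
Proof.
split.
- by apply: continuous_subspaceT; exact: continuous_step_solution.
- exact: step_solution_history.
- by move=> t t0; rewrite mul0r add0r mul1r; exact: step_solution_eq.
Qed.

(** With n = floor(t/tau), the second sum and [Jgen] are extended to k = n + 1, where t - k tau < 0
    makes the added term vanish; all sums then match [step_sum] term by term. *)
Lemma step_solution_closed_form t : 0 <= t ->
   step_solution t =
     (tau^-1)%:C *
     (\sum_(0 <= k < (delay_index tau t + 1).+1)
        lambda ^+ k *
        ((t + tau - tau * k%:R) `^ (alpha * k%:R + 1))%:C /
        (Gamma (alpha * k%:R + 2))%:C
      - \sum_(0 <= k < (delay_index tau t).+1)
        lambda ^+ k *
        ((t - tau * k%:R) `^ (alpha * k%:R + 1))%:C /
        (Gamma (alpha * k%:R + 2))%:C) *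
     y0%:C
     + Jgen alpha tau lambda f t.
Proof.
move=> t0; rewrite addn1; set n := delay_index tau t.
(* This keeps the base of every power nonnegative, so that the powers can be read as kernels. *)
have nt : n%:R * tau <= t.
  rewrite -ler_pdivlMr// /n /delay_index.
  have fl0 : (0 <= Num.floor (t / tau))%R by rewrite floor_ge0 divr_ge0// ltW.
  rewrite -[leLHS]/((`|Num.floor (t / tau)|%N : int)%:~R) abszE ger0_norm//.
  exact: floor_le.
have tn := delay_index_gt t; rewrite -/n in tn.
have ak1 k : alpha * k%:R + 1 != 0.
  by rewrite gt_eqF//; have := ak_ge0 k; lra.
have term_eq k x : 0 <= x ->
  lambda ^+ k * (x `^ (alpha * k%:R + 1))%:C / (Gamma (alpha * k%:R + 2))%:C
  = lambda ^+ k * (nker (alpha * k%:R + 2) x)%:C.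
  move=> x0; rewrite -mulrA -fmorphV -rmorphM/=.
  by rewrite (_ : alpha * k%:R + 2 = alpha * k%:R + 1 + 1) ?powR_nker//; ring.
have kt k m : (k <= m)%N -> tau * k%:R <= m%:R * tau.
  by move=> km; rewrite mulrC ler_pM2r// ler_nat.
rewrite (eq_big_nat _ _ (F2 := fun k =>
    lambda ^+ k * (nker (alpha * k%:R + 2) (t + tau - k%:R * tau))%:C)); last first.
  move=> k /andP[_ kn]; rewrite [_ * tau]mulrC; apply: term_eq.
  rewrite subr_ge0 (le_trans (kt k n.+1 _))// -natr1 mulrDl mul1r.
  by rewrite lerD2r.
rewrite [X in _ - X](eq_big_nat _ _ (F2 := fun k =>
    lambda ^+ k * (nker (alpha * k%:R + 2) (t - k%:R * tau))%:C)); last first.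
  move=> k /andP[_ kn]; rewrite [_ * tau]mulrC; apply: term_eq.
  by rewrite subr_ge0 (le_trans (kt k n _)).
(* Each summand is lambda^k times a fractional integral of f, and f equals its extension on the
   domain of integration. *)
have JE : Jgen alpha tau lambda f t = \sum_(0 <= k < n.+1) lambda ^+ k *
    (fracint_extend f (alpha * k%:R + alpha) (t - k%:R * tau))%:C.
  apply: eq_bigr => k _; rewrite -mulrA -fmorphV -rmorphM/=; congr (_ * _%:C).
  have b2 : 0 < alpha * k%:R + alpha by exact: ltr_wpDl.
  have [_ <-] := RLval_extend0 f_cont (t - k%:R * tau) b2.
  apply: (@eq_RLreal _ _ f) => r /andP[r0 _].
  by rewrite /extend0 max_l.
have -> : \sum_(0 <= k < n.+1)
    lambda ^+ k * (nker (alpha * k%:R + 2) (t - k%:R * tau))%:C =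
  \sum_(0 <= k < n.+2)
    lambda ^+ k * (nker (alpha * k%:R + 2) (t - k%:R * tau))%:C.
  by rewrite [RHS]big_nat_recr//= nker_le0 ?subr_le0 ?(ltW tn)// mulr0 addr0.
have {}JE : Jgen alpha tau lambda f t = \sum_(0 <= k < n.+2) lambda ^+ k *
    (fracint_extend f (alpha * k%:R + alpha) (t - k%:R * tau))%:C.
  rewrite JE [RHS]big_nat_recr//= fracint_extend_le0 ?subr_le0 ?(ltW tn)//.
  by rewrite mulr0 addr0.
rewrite JE /step_solution -/n /step_sum -sumrB mulr_sumr mulr_suml -big_split/=.
have alg (c : R[i]) (p q r : R) : c * (y0 / tau * (p - q) + r)%:C =
    (tau^-1)%:C * (c * p%:C - c * q%:C) * y0%:C + c * r%:C.
  by rewrite rmorphD !rmorphM rmorphB; ring.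
by apply: eq_bigr => k _; exact: alg.
Qed.

End delay_equation.

Theorem corollary8 (R : realType) (alpha tau : R) (lambda : R[i])
    (f : R -> R) (y0 : R)
    (alpha_gt0 : 0 < alpha) (alpha_lt1 : alpha < 1) (tau_gt0 : 0 < tau)
    (f_cont : {within `[0, +oo[, continuous f}) :
  let phi := fun t : R => (t / tau + 1) * y0 in
  (exists y : R -> R[i], is_delay_solution alpha tau lambda f phi y) /\
  (forall y : R -> R[i], is_delay_solution alpha tau lambda f phi y ->
   forall t : R, 0 <= t ->
   y t =
     (tau^-1)%:C *
     (\sum_(0 <= k < (delay_index tau t + 1).+1)
        lambda ^+ k *
        ((t + tau - tau * k%:R) `^ (alpha * k%:R + 1))%:C /
        (Gamma (alpha * k%:R + 2))%:C
      - \sum_(0 <= k < (delay_index tau t).+1)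
        lambda ^+ k *
        ((t - tau * k%:R) `^ (alpha * k%:R + 1))%:C /
        (Gamma (alpha * k%:R + 2))%:C) *
     y0%:C
     + Jgen alpha tau lambda f t).
Proof.
move=> phi; split.
  exists (step_solution alpha tau lambda f y0).
  exact: step_solution_is_solution.
move=> y ysol t t0.
have sol := step_solution_is_solution lambda y0 alpha_gt0 tau_gt0 f_cont.
rewrite (delay_solution_uniq tau_gt0 ysol sol); last first.
  by rewrite (le_trans _ t0)// oppr_le0 ltW.
exact: step_solution_closed_form.
Qed.
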